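(* Let $D=\mathbb{Z}_{(2)}$ and let $A=D_{\mathbf{H}}$ be the ring of Hurwitz quaternions over $D$. Then $\mathrm{Int}_{\mathbb{Q}}(A)=\{f\in\mathbb{Q}[X]\mid f(A)\subseteq A\}$ is a Prüfer domain.
   Context: $\mathbb{Z}_{(2)}$ is the localization of $\mathbb{Z}$ at the prime ideal $(2)$. For $D$ an overring of $\mathbb{Z}$ in $\mathbb{Q}$, the ring of Hurwitz quaternions over $D$ is $$D_{\mathbf{H}}=\{a_0+a_1\mathbf{i}+a_2\mathbf{j}+a_3\mathbf{k}\mid\text{either }a_i\in D\text{ for each }i,\text{ or }a_i\in D+\tfrac12\text{ for each }i\},$$ a subring of the rational quaternions, where $\mathbf{i}^2=\mathbf{j}^2=-1$ and $\mathbf{i}\mathbf{j}=\mathbf{k}=-\mathbf{j}\mathbf{i}$. Polynomials with rational coefficients are evaluated at elements of $A$ inside the division ring of rational quaternions. *)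

(* Defs.v *)
From HB Require Import structures.
From mathcomp Require Import all_boot all_order all_algebra.
From mathcomp Require Import boolp classical_sets.
From mathcomp Require Import ring zify.

Set Implicit Arguments.
Unset Strict Implicit.
Unset Printing Implicit Defensive.

Import Order.TTheory GRing.Theory Num.Theory.

Local Open Scope ring_scope.
Local Open Scope classical_set_scope.

Section Pruefer.
Variable R : idomainType.
Local Notation K := {fraction R}.
Implicit Types (I : set R) (M N J : set K).

Definition ideal_gen (s : seq R) : set R :=
  [set x | exists c : 'I_(size s) -> R, x = \sum_(i < size s) c i * s`_i].

Definition fg_ideal I : Prop := exists s : seq R, I = ideal_gen s.

Definition fractional_ideal M : Prop :=
  [/\ M 0,
      forall x y, M x -> M y -> M (x + y),
      forall (r : R) x, M x -> M (tofrac r * x) &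
      exists2 d : R, d != 0 & forall x, M x -> range (@tofrac R) (tofrac d * x)].

Definition fideal_mul M N : set K :=
  [set x | exists2 s : seq (K * K),
     (forall p, p \in s -> M p.1 /\ N p.2) & x = \sum_(p <- s) p.1 * p.2].

Definition invertible_ideal I : Prop :=
  exists2 J, fractional_ideal J &
    fideal_mul (@tofrac R @` I) J = range (@tofrac R).

Definition pruefer_domain : Prop :=
  forall I, fg_ideal I -> I <> [set 0] -> invertible_ideal I.

End Pruefer.

(* Quat a b c d is a + b i + c j + d k. *)
Record quat := Quat { qre : rat; qi : rat; qj : rat; qk : rat }.

Definition quat_tuple (q : quat) := (qre q, qi q, qj q, qk q).
Definition tuple_quat (t : rat * rat * rat * rat) :=
  let: (a, b, c, d) := t in Quat a b c d.
Lemma quat_tupleK : cancel quat_tuple tuple_quat. Proof. by case. Qed.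

HB.instance Definition _ := Equality.copy quat (can_type quat_tupleK).
HB.instance Definition _ := Choice.copy quat (can_type quat_tupleK).

Definition quat_add (p q : quat) :=
  Quat (qre p + qre q) (qi p + qi q) (qj p + qj q) (qk p + qk q).
Definition quat_opp (p : quat) := Quat (- qre p) (- qi p) (- qj p) (- qk p).
Definition quat_mul (p q : quat) :=
  Quat (qre p * qre q - qi p * qi q - qj p * qj q - qk p * qk q)
       (qre p * qi q + qi p * qre q + qj p * qk q - qk p * qj q)
       (qre p * qj q - qi p * qk q + qj p * qre q + qk p * qi q)
       (qre p * qk q + qi p * qj q - qj p * qi q + qk p * qre q).
Definition quat_scale (a : rat) (p : quat) :=
  Quat (a * qre p) (a * qi p) (a * qj p) (a * qk p).

Lemma quat_addA : associative quat_add.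
Proof. by move=> [????] [????] [????]; congr Quat => /=; ring. Qed.
Lemma quat_addC : commutative quat_add.
Proof. by move=> [????] [????]; congr Quat => /=; ring. Qed.
Lemma quat_add0 : left_id (Quat 0 0 0 0) quat_add.
Proof. by move=> [????]; congr Quat => /=; ring. Qed.
Lemma quat_addN : left_inverse (Quat 0 0 0 0) quat_opp quat_add.
Proof. by move=> [????]; congr Quat => /=; ring. Qed.
HB.instance Definition _ :=
  GRing.isZmodule.Build quat quat_addA quat_addC quat_add0 quat_addN.

Lemma quat_mulA : associative quat_mul.
Proof. by move=> [????] [????] [????]; congr Quat => /=; ring. Qed.
Lemma quat_mul1l : left_id (Quat 1 0 0 0) quat_mul.
Proof. by move=> [????]; congr Quat => /=; ring. Qed.
Lemma quat_mul1r : right_id (Quat 1 0 0 0) quat_mul.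
Proof. by move=> [????]; congr Quat => /=; ring. Qed.
Lemma quat_mulDl : left_distributive quat_mul +%R.
Proof. by move=> [????] [????] [????]; congr Quat => /=; ring. Qed.
Lemma quat_mulDr : right_distributive quat_mul +%R.
Proof. by move=> [????] [????] [????]; congr Quat => /=; ring. Qed.
Lemma quat_1neq0 : Quat 1 0 0 0 != 0.
Proof. by apply/eqP; case. Qed.
HB.instance Definition _ := GRing.Zmodule_isNzRing.Build quat
  quat_mulA quat_mul1l quat_mul1r quat_mulDl quat_mulDr quat_1neq0.

Lemma quat_scaleA a b p : quat_scale a (quat_scale b p) = quat_scale (a * b) p.
Proof. by case: p => ????; congr Quat => /=; ring. Qed.
Lemma quat_scale1 : left_id 1 quat_scale.
Proof. by move=> [????]; congr Quat => /=; ring. Qed.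
Lemma quat_scaleDr : right_distributive quat_scale +%R.
Proof. by move=> a [????] [????]; congr Quat => /=; ring. Qed.
Lemma quat_scaleDl p : {morph quat_scale^~ p : a b / a + b}.
Proof. by move=> a b; case: p => ????; congr Quat => /=; ring. Qed.
HB.instance Definition _ := GRing.Zmodule_isLmodule.Build rat quat
  quat_scaleA quat_scale1 quat_scaleDr quat_scaleDl.

Lemma quat_scaleAl (a : rat) (p q : quat) : a *: (p * q) = a *: p * q.
Proof. by case: p q => [????] [????]; congr Quat => /=; ring. Qed.
HB.instance Definition _ := GRing.Lmodule_isLalgebra.Build rat quat quat_scaleAl.
Lemma quat_scaleAr (a : rat) (p q : quat) : a *: (p * q) = p * (a *: q).
Proof. by case: p q => [????] [????]; congr Quat => /=; ring. Qed.
HB.instance Definition _ := GRing.Lalgebra_isAlgebra.Build rat quat quat_scaleAr.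

Lemma quat_relations (i := Quat 0 1 0 0) (j := Quat 0 0 1 0)
    (k := Quat 0 0 0 1) :
  [/\ i * i = -1, j * j = -1, i * j = k & j * i = - k].
Proof. by split; congr Quat. Qed.

(* The localization of Z at the prime ideal (2), as a subset of Q. *)
Definition Zloc2 : {pred rat} :=
  [pred x | `[< exists a b : int, ~~ (2 %| b)%Z /\ x = a%:~R / b%:~R >]].

Definition hurwitz (D : {pred rat}) : {pred quat} :=
  [pred q | [&& qre q \in D, qi q \in D, qj q \in D & qk q \in D] ||
            [&& qre q - 1 / 2 \in D, qi q - 1 / 2 \in D,
                qj q - 1 / 2 \in D & qk q - 1 / 2 \in D]].

Definition intQ (A : {pred quat}) : {pred {poly rat}} :=
  [pred f | `[< forall a, a \in A -> horner_alg a f \in A >]].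

Lemma Zloc2_subring : subring_closed Zloc2.
Proof.
have nd b : ~~ (2 %| b)%Z -> b%:~R != 0 :> rat.
  by rewrite intr_eq0; apply: contraNneq => ->; rewrite dvdz0.
have ndM b d : ~~ (2 %| b)%Z -> ~~ (2 %| d)%Z -> ~~ (2 %| b * d)%Z.
  by rewrite !dvdzE abszM Euclid_dvdM // negb_or => -> ->.
split.
- by apply/asboolP; exists 1, 1; rewrite divr1.
- move=> x y /asboolP[a [b [hb ->]]] /asboolP[c [d [hd ->]]]; apply/asboolP.
  exists (a * d - c * b), (b * d); split.
    exact: ndM.
  by rewrite rmorphB !rmorphM /=; field; rewrite !nd.
- move=> x y /asboolP[a [b [hb ->]]] /asboolP[c [d [hd ->]]]; apply/asboolP.
  exists (a * c), (b * d); split.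
    exact: ndM.
  by rewrite !rmorphM /=; field; rewrite !nd.
Qed.
HB.instance Definition _ := GRing.isSubringClosed.Build rat Zloc2 Zloc2_subring.

Lemma Zloc2_parity (x : rat) : x \in Zloc2 ->
  exists2 y, y \in Zloc2 & x = 2 * y \/ x = 2 * y + 1.
Proof.
move=> /asboolP[a [b [hb ->]]].
have nb : b%:~R != 0 :> rat.
  by rewrite intr_eq0; apply: contraNneq hb => ->; rewrite dvdz0.
case: (boolP (2 %| a)%Z) => [/dvdzP[c ->]|ha].
  exists (c%:~R / b%:~R); first by apply/asboolP; exists c, b.
  by left; rewrite rmorphM /=; field.
have /dvdzP[c hc] : (2 %| a - b)%Z by lia.
exists (c%:~R / b%:~R); first by apply/asboolP; exists c, b.
right; have -> : a = c * 2 + b by lia.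
by rewrite rmorphD rmorphM /=; field.
Qed.

Section HurwitzSubring.
Let D := Zloc2.
Let L (q : quat) := [&& qre q \in D, qi q \in D, qj q \in D & qk q \in D].
Let h := Quat (1 / 2) (1 / 2) (1 / 2) (1 / 2).
Local Notation H := (hurwitz D).

Let HP (q : quat) : reflect (exists2 l, L l & q = l \/ q = l + h) (q \in H).
Proof.
apply: (iffP orP) => [[]|[l Ll [->|->]]]; last 2 first.
- by left.
- by right; rewrite /= !addrK.
- by exists q => //; left.
- exists (q - h) => //; right; by rewrite subrK.
Qed.

Let LB p q : L p -> L q -> L (p - q).
Proof. by move=> /and4P[????] /and4P[????]; apply/and4P; split; exact: rpredB. Qed.
Let LD p q : L p -> L q -> L (p + q).
Proof. by move=> /and4P[????] /and4P[????]; apply/and4P; split; exact: rpredD. Qed.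
Let LM p q : L p -> L q -> L (p * q).
Proof.
move=> /and4P[????] /and4P[????]; apply/and4P.
by split; rewrite /= ?(rpredB, rpredD, rpredM).
Qed.
Let L1 : L 1. Proof. by rewrite /L /= ?rpred0 ?rpred1. Qed.
Let hh : h + h = Quat 1 1 1 1. Proof. by congr Quat => /=; field. Qed.
Let Lhh : L (h + h). Proof. by rewrite hh /L /= !rpred1. Qed.

Let HB p q : p \in H -> q \in H -> p - q \in H.
Proof.
move=> /HP[l Ll lE] /HP[m Lm mE].
have Llm := LB Ll Lm; apply/HP.
case: lE mE => -> [] ->.
- by exists (l - m) => //; left.
- exists (l - m - (h + h)); first exact: LB.
  by right; rewrite !opprD !addrA subrK.
- by exists (l - m) => //; right; rewrite addrAC.
- by exists (l - m) => //; left; rewrite opprD addrACA subrr addr0.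
Qed.
Let H0 : 0 \in H. Proof. by apply/HP; exists 0; [rewrite /L /= !rpred0|left]. Qed.
Let HD p q : p \in H -> q \in H -> p + q \in H.
Proof.
by move=> Hp Hq; rewrite -[q]opprK -[- q]sub0r; apply: (HB Hp); apply: (HB H0).
Qed.
Let LH l : L l -> l \in H. Proof. by move=> Ll; apply/HP; exists l => //; left. Qed.

Let HhL l : L l -> h * l \in H.
Proof.
case: l => a b c d /and4P[/= ha hb hc hd].
have [|y hy E] := @Zloc2_parity (a + b + c + d); first by rewrite !rpredD.
apply/HP; exists (Quat (y - b - c - d) (y - c) (y - d) (y - b)).
  by apply/and4P; split; rewrite /= ?(rpredB, rpredD).
by case: E => /(canRL (addrK _))/(canRL (addrK _))/(canRL (addrK _)) ->;
  [left|right]; congr Quat => /=; field.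
Qed.
Let HLh l : L l -> l * h \in H.
Proof.
case: l => a b c d /and4P[/= ha hb hc hd].
have [|y hy E] := @Zloc2_parity (a + b + c + d); first by rewrite !rpredD.
apply/HP; exists (Quat (y - b - c - d) (y - d) (y - b) (y - c)).
  by apply/and4P; split; rewrite /= ?(rpredB, rpredD).
by case: E => /(canRL (addrK _))/(canRL (addrK _))/(canRL (addrK _)) ->;
  [left|right]; congr Quat => /=; field.
Qed.
Let Hh : h \in H.
Proof. by apply/HP; exists 0; [rewrite /L /= !rpred0|right; rewrite add0r]. Qed.
Let Hhh : h * h \in H.
Proof.
have -> : h * h = h - 1 by congr Quat => /=; field.
exact: HB Hh (LH L1).
Qed.

Lemma hurwitz_subring : subring_closed (hurwitz Zloc2).
Proof.
split; [exact: LH|exact: HB|move=> p q /HP[l Ll lE] /HP[m Lm mE]].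
have Hlm := LH (LM Ll Lm).
case: lE mE => -> [] -> //; rewrite ?mulrDl ?mulrDr.
- exact: HD (HLh Ll).
- exact: HD (HhL Lm).
- by apply: HD; apply: HD => //; [exact: HLh|exact: HhL].
Qed.
End HurwitzSubring.
HB.instance Definition _ :=
  GRing.isSubringClosed.Build quat (hurwitz Zloc2) hurwitz_subring.

Record intQ_ring (A : {pred quat}) :=
  IntQ { intQ_val :> {poly rat}; _ : intQ_val \in intQ A }.

HB.instance Definition _ A := [isSub for @intQ_val A].
HB.instance Definition _ A := [Choice of intQ_ring A by <:].

Section IntQ.
Variable A : GRing.SubringClosed.type quat.

Lemma intQ_subring : subring_closed (intQ A).
Proof.
split=> [|f g /asboolP hf /asboolP hg|f g /asboolP hf /asboolP hg];
  apply/asboolP => a Aa.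
- by rewrite rmorph1 rpred1.
- by rewrite rmorphB; apply: rpredB; [exact: hf|exact: hg].
- by rewrite rmorphM; apply: rpredM; [exact: hf|exact: hg].
Qed.
HB.instance Definition _ :=
  GRing.isSubringClosed.Build {poly rat} (intQ A) intQ_subring.

HB.instance Definition _ := [SubChoice_isSubComNzRing of intQ_ring A by <:].

Definition intQ_unit : {pred intQ_ring A} :=
  [pred f | (val f \is a GRing.unit) && ((val f)^-1 \in intQ A)].
Definition intQ_inv (f : intQ_ring A) : intQ_ring A := insubd f (val f)^-1.

Lemma intQ_mulV : {in intQ_unit, left_inverse 1 intQ_inv *%R}.
Proof.
move=> f /andP[fu fA]; apply: val_inj.
by rewrite rmorphM rmorph1 /= val_insubd fA mulVr.
Qed.
Lemma intQ_unitP (f g : intQ_ring A) : g * f = 1 -> f \in intQ_unit.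
Proof.
move=> /(congr1 val); rewrite rmorphM rmorph1 /= => gf.
have fg : val f * val g = 1 by rewrite mulrC.
have fu : val f \is a GRing.unit by apply/unitrP; exists (val g).
apply/andP; split=> //.
by rewrite -[_^-1]mul1r -gf mulrK // (valP g).
Qed.
Lemma intQ_invN : {in [predC intQ_unit], intQ_inv =1 id}.
Proof.
move=> f; rewrite inE /= negb_and /intQ_inv => /orP[fu|fA].
  by apply: val_inj; rewrite val_insubd invr_out ?(valP f).
by apply: val_inj; rewrite val_insubd (negbTE fA).
Qed.
HB.instance Definition _ := GRing.ComNzRing_hasMulInverse.Build (intQ_ring A)
  intQ_mulV intQ_unitP intQ_invN.

Lemma intQ_integral : GRing.integral_domain_axiom (intQ_ring A).
Proof.
move=> f g /(congr1 val); rewrite rmorphM rmorph0 /= => /eqP.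
by rewrite mulf_eq0.
Qed.
HB.instance Definition _ := GRing.ComUnitRing_isIntegral.Build (intQ_ring A)
  intQ_integral.
End IntQ.

(* Main.v *)
(** Over [Q_2] the quaternions form a division algebra whose maximal order is the
    unit ball of the multiplicative non-archimedean absolute value
    [|q| = |N(q)|_2], with residue field [F_4]; so [A] is the set of [q] with
    [|q| <= 1], and [f] lies in [Int(A)] iff [|f(a)| <= 1] for all [a] in [A].

    Let [f, g] in [Int(A)]; after dividing by their gcd in [Q[X]] the ideal they
    generate contains a nonzero constant [c].  As [x^4 - x + 1] has no zero in
    [F_4], [F = f^4 - f g^3 + g^4] satisfies [|F(a)| = max(|f(a)|, |g(a)|)^4],
    which is bounded below by a power of [|c|].  Composing [F] with a polynomial
    [e] such that [e(0) = 1] and [|e(q)| <= |c|] for all [q] in [A] that are not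
    too small, [psi = (1 - e(F)) / F] is a polynomial playing the role of [1 / F]
    up to an error in [c Int(A)].  This yields [x, y] in [Q[X]] with
    [g x + f y = 1] and [f x, g x, f y, g y] in [Int(A)], so every two-generated
    ideal is locally principal; partitions of unity then handle any finite
    number of generators. *)

Require Import Defs.
From mathcomp Require Import all_boot all_order all_algebra.
From mathcomp Require Import boolp classical_sets.
From mathcomp Require Import ring lra zify.

Set Implicit Arguments.
Unset Strict Implicit.
Unset Printing Implicit Defensive.

Import Order.TTheory GRing.Theory Num.Theory.

Local Open Scope ring_scope.

(** * The 2-adic absolute value on the rationals *)

Definition part2 (z : int) : rat := ((absz z)`_2)%N%:R.

Lemma part2_gt0 z : 0 < part2 z.
Proof. by rewrite ltr0n part_gt0. Qed.

Lemma part2M y z : y != 0 -> z != 0 -> part2 (y * z) = part2 y * part2 z.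
Proof. by move=> y0 z0; rewrite /part2 abszM partnM ?absz_gt0 // natrM. Qed.

Lemma part2_odd z : ~~ (2 %| z)%Z -> part2 z = 1.
Proof. by move=> h; rewrite /part2 part_p'nat // p'natE. Qed.

Lemma part2_even z : z != 0 -> (2 %| z)%Z -> 2 <= part2 z.
Proof.
move=> z0 h; rewrite ler_nat; apply: dvdn_leq; first exact: part_gt0.
rewrite p_part; apply: dvdn_exp => //.
by rewrite logn_gt0 mem_primes absz_gt0 z0.
Qed.

(** This is $|x|_2 = 2^{-v_2(x)}$, kept rational so that all estimates take place in [rat]. *)
Definition abs2 (x : rat) : rat :=
  if x == 0 then 0 else part2 (denq x) / part2 (numq x).

Lemma abs2_0 : abs2 0 = 0.
Proof. by rewrite /abs2 eqxx. Qed.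

Lemma abs2_frac (a b : int) : a != 0 -> b != 0 ->
  abs2 (a%:~R / b%:~R) = part2 b / part2 a.
Proof.
move=> a0 b0; have b0' : b%:~R != 0 :> rat by rewrite intr_eq0.
have x0 : a%:~R / b%:~R != 0 :> rat by rewrite mulf_neq0 ?invr_eq0 ?intr_eq0.
rewrite /abs2 (negbTE x0); set x := _ / _ in x0 *.
have p0 z : part2 z != 0 by rewrite gt_eqF ?part2_gt0.
apply/eqP; rewrite eqr_div //.
rewrite -!part2M ?denq_neq0 ?numq_eq0 //; apply/eqP; congr part2; apply/eqP.
rewrite -(eqr_int rat) !rmorphM /= numqE /x; apply/eqP; field; exact: b0'.
Qed.

Lemma abs2_gt0 x : (0 < abs2 x) = (x != 0).
Proof.
by rewrite /abs2; case: eqP => //= _; rewrite divr_gt0 ?part2_gt0.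
Qed.

Lemma abs2_ge0 x : 0 <= abs2 x.
Proof. by have [->|] := eqVneq x 0; rewrite ?abs2_0 // -abs2_gt0 => /ltW. Qed.

Lemma abs2M x y : abs2 (x * y) = abs2 x * abs2 y.
Proof.
have [->|x0] := eqVneq x 0; first by rewrite mul0r abs2_0 mul0r.
have [->|y0] := eqVneq y 0; first by rewrite mulr0 abs2_0 mulr0.
rewrite {2 3}/abs2 (negbTE x0) (negbTE y0).
have -> : x * y = (numq x * numq y)%:~R / (denq x * denq y)%:~R.
  by rewrite !rmorphM /= -{1}(divq_num_den x) -{1}(divq_num_den y) mulf_div.
rewrite abs2_frac ?mulf_neq0 ?numq_eq0 ?denq_neq0 //.
by rewrite !part2M ?numq_eq0 ?denq_neq0 // mulf_div.
Qed.

(** In a reduced fraction an even denominator forces an odd numerator, hence an absolute value of at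
    least 2. *)
Lemma abs2_le1 x : (abs2 x <= 1) = (x \in Zloc2).
Proof.
have [->|x0] := eqVneq x 0; first by rewrite abs2_0 rpred0 ler01.
apply/idP/asboolP => [|[a [b [b2 xE]]]].
  rewrite /abs2 (negbTE x0) ler_pdivrMr ?part2_gt0 // mul1r => h.
  exists (numq x), (denq x); split; last by rewrite divq_num_den.
  apply/negP => d2; have := le_trans (part2_even (denq_neq0 x) d2) h.
  suff n2 : ~~ (2 %| numq x)%Z by rewrite part2_odd.
  apply/negP => n2; have := coprime_num_den x.
  by move=> /(coprime_dvdl n2); rewrite prime_coprime //; apply/negP/negPn.
have b0 : b != 0 by apply: contraNneq b2 => ->; rewrite dvdz0.
have a0 : a != 0 by apply: contraNneq x0; rewrite xE => ->; rewrite mul0r.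
rewrite xE abs2_frac // part2_odd // mul1r invf_le1 ?part2_gt0 //.
by rewrite /part2 ler1n part_gt0.
Qed.

Lemma abs2_2 : abs2 2 = 2^-1.
Proof.
have := @abs2_frac 2 1 isT isT; rewrite divr1 => ->.
by rewrite part2_odd // /part2 part_pnat_id // mul1r.
Qed.

Lemma abs2_1 : abs2 1 = 1.
Proof.
by have := @abs2_frac 1 1 isT isT; rewrite divr1 part2_odd // divr1.
Qed.

Lemma abs2X x n : abs2 (x ^+ n) = abs2 x ^+ n.
Proof. by elim: n => [|n IH]; rewrite ?abs2_1 // !exprS abs2M IH. Qed.

Lemma abs2V x : abs2 x^-1 = (abs2 x)^-1.
Proof.
have [->|x0] := eqVneq x 0; first by rewrite !(invr0, abs2_0).
have h : abs2 x != 0 by rewrite gt_eqF ?abs2_gt0.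
by apply: (mulfI h); rewrite -abs2M !divff // abs2_1.
Qed.

Lemma abs2_lt1 x : abs2 x < 1 -> abs2 x <= 2^-1.
Proof.
have [->|x0] := eqVneq x 0; first by rewrite abs2_0.
move=> xlt1; have := ltW xlt1; rewrite abs2_le1 => /asboolP[a [b [b2 xE]]].
have b0 : b != 0 by apply: contraNneq b2 => ->; rewrite dvdz0.
have a0 : a != 0 by apply: contraNneq x0; rewrite xE => ->; rewrite mul0r.
move: xlt1; rewrite xE abs2_frac // part2_odd // !mul1r.
rewrite invf_lt1 ?part2_gt0 // lef_pV2 ?posrE ?part2_gt0 //.
by rewrite /part2 ltr1n ler_nat.
Qed.

(** Division by [2 ^+ n] reduces this to the gap between $1/2$ and 1. *)
Lemma abs2_discrete x n : abs2 x < 2^-1 ^+ n -> abs2 x <= 2^-1 ^+ n.+1.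
Proof.
move=> h; have := @abs2_lt1 (x / 2 ^+ n).
rewrite abs2M abs2V abs2X abs2_2 ltr_pdivrMr ?exprn_gt0 // mul1r.
by move=> /(_ h); rewrite ler_pdivrMr ?exprn_gt0 // exprS.
Qed.

(** * The quaternion norm and membership in the Hurwitz ring *)

Definition qnorm (q : quat) : rat := qre q ^+ 2 + qi q ^+ 2 + qj q ^+ 2 + qk q ^+ 2.
Definition qconj (q : quat) : quat := Quat (qre q) (- qi q) (- qj q) (- qk q).

Lemma qnormM p q : qnorm (p * q) = qnorm p * qnorm q.
Proof. by case: p q => [????] [????]; rewrite /qnorm /=; ring. Qed.

Lemma qnormZ c q : qnorm (c *: q) = c ^+ 2 * qnorm q.
Proof. by case: q => ????; rewrite /qnorm /=; ring. Qed.

Lemma qnormN q : qnorm (- q) = qnorm q.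
Proof. by case: q => ????; rewrite /qnorm /=; ring. Qed.

Lemma qnorm1 : qnorm 1 = 1.
Proof. by []. Qed.

Lemma qnorm_eq0 q : (qnorm q == 0) = (q == 0).
Proof.
apply/eqP/eqP => [|->] //; case: q => a b c d; rewrite /qnorm /= => h.
by congr Quat; nra.
Qed.

Lemma mulqVq q : q != 0 -> ((qnorm q)^-1 *: qconj q) * q = 1.
Proof.
rewrite -qnorm_eq0; case: q => a b c d; rewrite /qnorm /= => h.
by congr Quat => /=; field.
Qed.

Lemma Zloc2_odd_frac (a b : int) : ~~ (2 %| b)%Z -> a%:~R / b%:~R \in Zloc2.
Proof. by move=> b2; apply/asboolP; exists a, b. Qed.

Lemma sqrz_mod (x : int) :
  (2 %| x)%Z /\ (exists z, x ^+ 2 = z * 4) \/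
  ~~ (2 %| x)%Z /\ (exists z, x ^+ 2 = z * 8 + 1).
Proof.
case: (boolP (2 %| x)%Z) => [/dvdzP[y ->]|x2]; [left|right]; split=> //.
  by exists (y ^+ 2); ring.
have /dvdzP[y yE] : (2 %| x - 1)%Z by lia.
have {yE} -> : x = y * 2 + 1 by lia.
have /dvdzP[z zE] : (2 %| y * (y + 1))%Z.
  case: (boolP (2 %| y)%Z) => [|y2]; first exact: dvdz_mulr.
  by apply: dvdz_mull; lia.
exists z; transitivity (4 * (y * (y + 1)) + 1); first by ring.
by rewrite zE; ring.
Qed.

(** Squares are 0 modulo 4 or 1 modulo 8, so the number of odd entries is 0 or 4, and four odd
    squares add up to 4 modulo 8. *)
Lemma four_squares_mod4 (a b c d : int) :
  (4 %| a ^+ 2 + b ^+ 2 + c ^+ 2 + d ^+ 2)%Z ->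
  [&& (2 %| a)%Z, (2 %| b)%Z, (2 %| c)%Z & (2 %| d)%Z] \/
  [/\ [&& ~~ (2 %| a)%Z, ~~ (2 %| b)%Z, ~~ (2 %| c)%Z & ~~ (2 %| d)%Z] &
      ~~ (8 %| a ^+ 2 + b ^+ 2 + c ^+ 2 + d ^+ 2)%Z].
Proof.
case: (sqrz_mod a) => [[ha [x Ea]]|[ha [x Ea]]];
case: (sqrz_mod b) => [[hb [y Eb]]|[hb [y Eb]]];
case: (sqrz_mod c) => [[hc [z Ec]]|[hc [z Ec]]];
case: (sqrz_mod d) => [[hd [t Ed]]|[hd [t Ed]]];
rewrite Ea Eb Ec Ed => h4; rewrite ?(negbTE ha) ?(negbTE hb) ?(negbTE hc) ?(negbTE hd);
rewrite ?ha ?hb ?hc ?hd; first by left.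
all: clear -h4; try by exfalso; lia.
by right; split=> //; lia.
Qed.

(** Induction on [k] halves the coordinates while all are even. They can all be odd only for
    exponent 1, since a larger exponent makes the sum divisible by 8; the quotients then lie in $D +
    1/2$. *)
Lemma hurwitz_of_dvd k (o a b c d : int) : ~~ (2 %| o)%Z ->
  (4 ^+ k %| a ^+ 2 + b ^+ 2 + c ^+ 2 + d ^+ 2)%Z ->
  (2 ^+ k * o%:~R)^-1 *: Quat a%:~R b%:~R c%:~R d%:~R \in hurwitz Zloc2.
Proof.
move=> o2; have o0 : o%:~R != 0 :> rat.
  by rewrite intr_eq0; apply: contraNneq o2 => ->; rewrite dvdz0.
elim: k a b c d => [|k IH] a b c d.
  move=> _; apply/orP; left; rewrite /= expr0 mul1r ![_^-1 * _]mulrC.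
  by rewrite !Zloc2_odd_frac.
have even_case : (2 %| a)%Z -> (2 %| b)%Z -> (2 %| c)%Z -> (2 %| d)%Z ->
    (4 ^+ k.+1 %| a ^+ 2 + b ^+ 2 + c ^+ 2 + d ^+ 2)%Z ->
    (2 ^+ k.+1 * o%:~R)^-1 *: Quat a%:~R b%:~R c%:~R d%:~R \in hurwitz Zloc2.
  move=> /dvdzP[a' ->] /dvdzP[b' ->] /dvdzP[c' ->] /dvdzP[d' ->].
  have -> : (a' * 2) ^+ 2 + (b' * 2) ^+ 2 + (c' * 2) ^+ 2 + (d' * 2) ^+ 2
      = 4 * (a' ^+ 2 + b' ^+ 2 + c' ^+ 2 + d' ^+ 2) by ring.
  rewrite [4 ^+ _]exprS dvdz_mul2l // => /IH {}IH; rewrite !rmorphM /=.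
  set q := _ *: _ in IH; rewrite (_ : _ *: _ = q) //.
  by congr Quat => /=; rewrite exprS; field; rewrite o0 expf_neq0.
case: k IH even_case => [|k] IH even_case h.
  have : [&& (2 %| a)%Z, (2 %| b)%Z, (2 %| c)%Z & (2 %| d)%Z] ||
         [&& (2 %| a - o)%Z, (2 %| b - o)%Z, (2 %| c - o)%Z & (2 %| d - o)%Z].
    have [->//|[/and4P[a2 b2 c2 d2] _]] := four_squares_mod4 h.
    have odd_sub x : ~~ (2 %| x)%Z -> (2 %| x - o)%Z by move: o2; clear; lia.
    by apply/orP; right; rewrite !odd_sub.
  case/orP => /and4P[]; first by move=> *; apply: even_case.
  move=> a2 b2 c2 d2; apply/orP; right; rewrite /= expr1.
  have half x : (2 %| x - o)%Z -> (2 * o%:~R)^-1 * x%:~R - 1 / 2 \in Zloc2.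
    move=> /dvdzP[y /(canRL (subrK _)) ->].
    rewrite (_ : _ - _ = y%:~R / o%:~R) ?Zloc2_odd_frac //.
    by rewrite rmorphD rmorphM /=; field.
  by rewrite !half.
have h8 : (8 %| a ^+ 2 + b ^+ 2 + c ^+ 2 + d ^+ 2)%Z.
  by apply: dvdz_trans h; rewrite !exprS mulrA dvdz_mulr.
have h4 : (4 %| a ^+ 2 + b ^+ 2 + c ^+ 2 + d ^+ 2)%Z by apply: dvdz_trans h8.
have [/and4P[????]|[_]] := four_squares_mod4 h4; last by rewrite h8.
exact: even_case.
Qed.

(** Clearing denominators writes $q = v / (2^k o)$ with $o$ odd and $v$ integral. The norm of $q$
    has an odd denominator, prime to $4^k$, so $4^k$ divides the norm of $v$. *)
Lemma hurwitz_of_norm q : qnorm q \in Zloc2 -> q \in hurwitz Zloc2.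
Proof.
case: q => a b c d.
pose m := denq a * denq b * denq c * denq d.
have m0 : m != 0 by rewrite !mulf_neq0 ?denq_neq0.
have mint (x : rat) (y : int) : m = denq x * y ->
    exists z : int, x = m%:~R^-1 * z%:~R.
  move=> mE; suff E : m%:~R * x = (numq x * y)%:~R.
    by exists (numq x * y); rewrite -E mulKf ?intr_eq0.
  by rewrite mE !rmorphM /= numqE; ring.
have [|x xE] := @mint a (denq b * denq c * denq d); first by rewrite /m; ring.
have [|y yE] := @mint b (denq a * denq c * denq d); first by rewrite /m; ring.
have [|z zE] := @mint c (denq a * denq b * denq d); first by rewrite /m; ring.
have [|t tE] := @mint d (denq a * denq b * denq c); first by rewrite /m; ring.
have mge0 : 0 <= m by rewrite !mulr_ge0 ?denq_ge0.
clearbody m.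
have [k [o o2 mE]] : exists k, exists2 o : int, ~~ (2 %| o)%Z & m = 2 ^+ k * o.
  have /(@pfactor_coprime 2 _ isT)[o o2 mE] : (0 < `|m|)%N by rewrite absz_gt0.
  exists (logn 2 `|m|%N), (Posz o); first by rewrite dvdzE -prime_coprime.
  by rewrite -{1}(gez0_abs mge0) {1}mE PoszM mulrC -rmorphXn /= natz.
have mQ : m%:~R = 2 ^+ k * o%:~R :> rat by rewrite mE rmorphM rmorphXn.
have -> : Quat a b c d = (2 ^+ k * o%:~R)^-1 *: Quat x%:~R y%:~R z%:~R t%:~R.
  by rewrite -mQ xE yE zE tE.
rewrite qnormZ => /asboolP[n [l [l2 E]]]; apply: hurwitz_of_dvd => //.
have o0 : o%:~R != 0 :> rat.
  by rewrite intr_eq0; apply: contraNneq o2 => ->; rewrite dvdz0.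
have l0 : l%:~R != 0 :> rat.
  by rewrite intr_eq0; apply: contraNneq l2 => ->; rewrite dvdz0.
have k0 : 2 ^+ k != 0 :> rat by rewrite expf_neq0.
have cop : coprimez (4 ^+ k) l.
  have -> : 4 ^+ k = 2 ^+ (2 * k) :> int by rewrite exprM.
  by rewrite coprimezXl // coprimezE prime_coprime.
rewrite -(Gauss_dvdzl _ cop); apply/dvdzP; exists (n * o ^+ 2).
apply/eqP; rewrite -(eqr_int rat) !(rmorphM, rmorphD, rmorphXn) /=; apply/eqP.
have -> : 4 ^+ k = (2 ^+ k) ^+ 2 :> rat by rewrite -exprM mulnC (exprM 2 2).
have -> : n%:~R = n%:~R / l%:~R * l%:~R :> rat by rewrite divfK.
by rewrite -E /qnorm /=; field; rewrite o0 k0.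
Qed.

(** In the half-integral case the four quarters add up to 1 and the cross terms to $a' + b' + c' +
    d'$. *)
Lemma hurwitz_trace_norm q : q \in hurwitz Zloc2 ->
  (2 * qre q \in Zloc2) && (qnorm q \in Zloc2).
Proof.
case: q => a b c d /orP[] /and4P /= [ha hb hc hd]; rewrite /qnorm /=.
  have h2 : 2 \in Zloc2 := rpred_nat _ 2.
  by apply/andP; split; rewrite ?(h2, rpredM, rpredD, rpredX).
set a' := a - _ in ha; set b' := b - _ in hb.
set c' := c - _ in hc; set d' := d - _ in hd.
have -> : 2 * a = 1 + 2 * a' by rewrite /a'; field.
have -> : a ^+ 2 + b ^+ 2 + c ^+ 2 + d ^+ 2 =
    1 + (a' + b' + c' + d') + (a' ^+ 2 + b' ^+ 2 + c' ^+ 2 + d' ^+ 2).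
  by rewrite /a' /b' /c' /d'; field.
clearbody a' b' c' d'.
have h2 : 2 \in Zloc2 := rpred_nat _ 2.
have h1 : 1 \in Zloc2 := rpred1 _.
by apply/andP; split; rewrite ?(h1, h2, rpredM, rpredD, rpredX).
Qed.

(** * The absolute value on the quaternions *)

Definition qabs (q : quat) : rat := abs2 (qnorm q).

Lemma qabs_le1 q : (qabs q <= 1) = (q \in hurwitz Zloc2).
Proof.
rewrite /qabs abs2_le1; apply/idP/idP; first exact: hurwitz_of_norm.
by move/hurwitz_trace_norm/andP => -[].
Qed.

Lemma qabsM p q : qabs (p * q) = qabs p * qabs q.
Proof. by rewrite /qabs qnormM abs2M. Qed.

Lemma qabs1 : qabs 1 = 1.
Proof. by rewrite /qabs qnorm1 abs2_1. Qed.

Lemma qabsX q n : qabs (q ^+ n) = qabs q ^+ n.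
Proof. by elim: n => [|n IH]; rewrite ?qabs1 // !exprS qabsM IH. Qed.

Lemma qabsZ c q : qabs (c *: q) = abs2 c ^+ 2 * qabs q.
Proof. by rewrite /qabs qnormZ abs2M abs2X. Qed.

Lemma qabsN q : qabs (- q) = qabs q.
Proof. by rewrite /qabs qnormN. Qed.

Lemma qabs_ge0 q : 0 <= qabs q.
Proof. exact: abs2_ge0. Qed.

Lemma qabs_gt0 q : (0 < qabs q) = (q != 0).
Proof. by rewrite abs2_gt0 qnorm_eq0. Qed.

Lemma qabs0 : qabs 0 = 0.
Proof. by rewrite /qabs abs2_0. Qed.

Lemma qdiv (p q : quat) : q != 0 -> exists r : quat, p = r * q.
Proof.
by move=> /mulqVq qV; exists (p * ((qnorm q)^-1 *: qconj q)); rewrite -mulrA qV mulr1.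
Qed.

(** After division by the larger term, the ultrametric inequality says that the unit ball is closed
    under adding 1, which holds because it is a subring. *)
Lemma qabsD p q r : qabs p <= r -> qabs q <= r -> qabs (p + q) <= r.
Proof.
wlog pq : p q / qabs p <= qabs q => [th pr qr|pr qr].
  by have [/th|/ltW/th] := leP (qabs p) (qabs q); last rewrite addrC; apply.
have [q0|q0] := eqVneq q 0; first by rewrite q0 addr0.
apply: le_trans qr; have [s ps] := qdiv p q0.
have -> : p + q = (s + 1) * q by rewrite mulrDl mul1r -ps.
move: pq; rewrite ps !qabsM !ger_pMl ?qabs_gt0 // !qabs_le1 => hs.
by rewrite rpredD ?rpred1.
Qed.

Lemma qabsB p q r : qabs p <= r -> qabs q <= r -> qabs (p - q) <= r.
Proof. by move=> hp hq; apply: qabsD; rewrite ?qabsN. Qed.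

Lemma qabsD_lt p q : qabs p < qabs q -> qabs (p + q) = qabs q.
Proof.
move=> pq; apply/le_anti; rewrite qabsD ?(ltW pq) //=.
rewrite leNgt; apply/negP => h.
have : qabs (p + q - p) <= Num.max (qabs p) (qabs (p + q)).
  by apply: qabsB; rewrite le_max lexx ?orbT.
by rewrite addrC addKr le_max !leNgt pq h.
Qed.

(* The residue field of the unit ball is F_4. *)
Lemma qabs_frobenius q : qabs q <= 1 -> qabs (q ^+ 4 - q) <= 2^-1.
Proof.
rewrite qabs_le1 => /hurwitz_trace_norm/andP[ht hn].
rewrite /qabs; apply: abs2_lt1.
have abs2lt x : x / 2 \in Zloc2 -> abs2 x < 1.
  by rewrite -abs2_le1 abs2M abs2V abs2_2; lra.
apply: abs2lt; have -> : q ^+ 4 - q = q * (q - 1) * (q ^+ 2 + q + 1).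
  rewrite -mulrA; have -> : q ^+ 2 + q + 1 = \sum_(i < 3) q ^+ i.
    by rewrite !big_ord_recr big_ord0 /= add0r addrC [1 + _]addrC addrA.
  by rewrite -subrX1 mulrBr mulr1 -exprS.
set t := 2 * qre q in ht; set n := qnorm q in hn.
(* The norms of the three factors are polynomials in the trace [t] and the norm [n]. The first is
   even if [n] is even, the second if [n] is odd and [t] even, the third if both are odd. *)
have -> : qnorm (q * (q - 1) * (q ^+ 2 + q + 1)) = n * (n - t + 1) *
   ((1 + t) ^+ 2 * n + (1 + t) * (1 - n) * t + (1 - n) ^+ 2).
  rewrite /n /t !qnormM; congr (_ * _ * _).
    by case: q {ht hn t n} => ????; rewrite /qnorm /=; ring.
  by case: q {ht hn t n} => ????; rewrite /qnorm /=; ring.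
have h2 : 2 \in Zloc2 := rpred_nat _ 2.
have h1 : 1 \in Zloc2 := rpred1 _.
clearbody t n; have [n' hn' [nE|nE]] := Zloc2_parity hn.
  rewrite (_ : _ / 2 = n' * (n - t + 1) *
    ((1 + t) ^+ 2 * n + (1 + t) * (1 - n) * t + (1 - n) ^+ 2));
    last by rewrite nE; field.
  by rewrite ?(h1, h2, rpredM, rpredD, rpredN, rpredX).
have [t' ht' [tE|tE]] := Zloc2_parity ht.
  rewrite (_ : _ / 2 = n * (n' - t' + 1) *
    ((1 + t) ^+ 2 * n + (1 + t) * (1 - n) * t + (1 - n) ^+ 2));
    last by rewrite nE tE; field.
  by rewrite ?(h1, h2, rpredM, rpredD, rpredN, rpredX).
rewrite (_ : _ / 2 = n * (n - t + 1) *
   ((1 + t') * (1 + t) * n + (1 + t') * (1 - n) * t + n' * (n - 1)));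
    last by rewrite nE tE; field.
by rewrite ?(h1, h2, rpredM, rpredD, rpredN, rpredX).
Qed.

(** * From locally principal ideals to Prüfer domains *)

Section ArithmeticalPruefer.
Variable R : idomainType.

(** Every ideal $(f, g)$ is locally principal: $f \in (g)$ where $u$ is invertible, $g \in (f)$
    where $1 - u$ is. *)
Definition arithmetical : Prop :=
  forall f g : R, exists u v w, u * f = v * g /\ (1 - u) * g = w * f.

(** When $t$ is appended, each weight $u_k$ splits into $u_k p_k$ and $u_k (1 - p_k)$, where $p_k t
    \in (s_k)$ and $(1 - p_k) s_k \in (t)$; the second pieces are gathered at $t$. *)
Lemma locally_principal (s : seq R) : arithmetical -> (0 < size s)%N ->
  exists2 u : 'I_(size s) -> R, \sum_i u i = 1 &
    forall i j : 'I_(size s), exists r, u i * s`_j = r * s`_i.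
Proof.
move=> arith; elim/last_ind: s => [//|s t IH] _.
have sE : size (rcons s t) = (size s).+1 by rewrite size_rcons.
(* Weights indexed by [nat] avoid transporting ordinals along [sE]. *)
suff [u u1 uP] : exists2 u : nat -> R, \sum_(i < (size s).+1) u i = 1 &
    forall i j, (i < (size s).+1)%N -> (j < (size s).+1)%N ->
      exists r, u i * (rcons s t)`_j = r * (rcons s t)`_i.
  exists (fun i => u i); first by rewrite sE.
  by move=> i j; apply: uP; rewrite -sE ltn_ord.
have [s0|/IH[u u1 uP]] := posnP (size s).
  exists (fun=> 1); first by rewrite s0 big_ord1.
  by move=> [|i] [|j]; rewrite s0 // => _ _; exists 1.
pose u' i := if insub i is Some k then u k else 0.
have u'E (i : 'I_(size s)) : u' i = u i by rewrite /u' valK.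
have /choice[p pP] : forall i : nat, exists p, exists v w,
  p * t = v * s`_i /\ (1 - p) * s`_i = w * t by move=> i; exact: arith.
have sN i : (i < size s)%N -> (rcons s t)`_i = s`_i by rewrite nth_rcons => ->.
have tN : (rcons s t)`_(size s) = t by rewrite nth_rcons ltnn eqxx.
exists (fun i => if (i < size s)%N then u' i * p i
                 else \sum_(k < size s) u' k * (1 - p k)).
  rewrite big_ord_recr /= ltnn -[RHS]u1 -big_split /=.
  by apply: eq_bigr => i _; rewrite ltn_ord -mulrDr subrKC mulr1 u'E.
move=> i j; rewrite !ltnS.
have key k : (k < size s)%N -> (j <= size s)%N ->
    exists a b, u' k * p k * (rcons s t)`_j = a * s`_k
             /\ u' k * (1 - p k) * (rcons s t)`_j = b * t.
  move=> kn jn; have [v [w [E1 E2]]] := pP k.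
  have [jE|jE] := eqVneq j (size s).
    by exists (u' k * v), (u' k * (1 - p k)); rewrite jE tN -mulrA E1 mulrA.
  have jl : (j < size s)%N by rewrite ltn_neqAle jE.
  have [r rE] := uP (Ordinal kn) (Ordinal jl).
  move: rE; rewrite /= -u'E /= => rE; exists (p k * r), (r * w); rewrite sN //.
  by split; [rewrite mulrAC rE mulrC mulrA|rewrite mulrAC rE -!mulrA -E2; ring].
move=> il jl; have [ilt|ige] := ltnP i (size s).
  by have [a [_ [E _]]] := key i ilt jl; exists a; rewrite E sN.
have -> : i = size s by apply/eqP; rewrite eqn_leq il.
have /choice[b bP] : forall k : 'I_(size s), exists b,
    u' k * (1 - p k) * (rcons s t)`_j = b * t.
  by move=> k; have [_ [b [_ E]]] := key k (ltn_ord k) jl; exists b.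
exists (\sum_k b k); rewrite tN !mulr_suml.
by apply: eq_bigr => k _; exact: bP.
Qed.

Local Open Scope classical_set_scope.

Lemma arithmetical_pruefer : arithmetical -> pruefer_domain R.
Proof.
move=> arith _ [s ->] In0.
have memI i : (i < size s)%N -> ideal_gen s s`_i.
  move=> il; exists (fun k => (k == Ordinal il)%:R).
  rewrite (bigD1 (Ordinal il)) //= eqxx mul1r big1 ?addr0 // => k /negPf ->.
  by rewrite mul0r.
have [d [dl d0]] : exists d, (d < size s)%N /\ s`_d != 0.
  apply: contrapT => h; apply: In0; apply/seteqP; split=> [x [c ->]|x ->] /=.
    rewrite big1 // => i _; have [->|n0] := eqVneq s`_i 0; first exact: mulr0.
    by case: h; exists i.
  by exists (fun=> 0); rewrite big1 // => i _; rewrite mul0r.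
have s0 : (0 < size s)%N by exact: leq_ltn_trans dl.
have [u u1 uP] := locally_principal arith s0.
(* Since $u_i s_d$ is a multiple of $s_i$ and $s_d \neq 0$, a zero generator has weight 0; division
   by $s_i = 0$ below then gives the right value 0. *)
have u0 (i : 'I_(size s)) : s`_i = 0 -> u i = 0.
  move=> si; have [r] := uP i (Ordinal dl); rewrite si mulr0 => /eqP.
  by rewrite mulf_eq0 (negbTE d0) orbF => /eqP.
pose rangeR := range (@tofrac R).
have R0 : rangeR 0 by exists 0; rewrite ?rmorph0.
have RD x y : rangeR x -> rangeR y -> rangeR (x + y).
  by move=> [a _ <-] [b _ <-]; exists (a + b); rewrite ?rmorphD.
have RM x y : rangeR x -> rangeR y -> rangeR (x * y).
  by move=> [a _ <-] [b _ <-]; exists (a * b); rewrite ?rmorphM.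
have RR r : rangeR (tofrac r) by exists r.
(* The inverse is the conductor $(R : I)$. It contains every $u_i / s_i$, and $\sum_i s_i (u_i /
   s_i) = 1$. *)
pose J := [set x | forall y, ideal_gen s y -> rangeR (tofrac y * x)].
exists J.
  split=> [y _|x y Jx Jy z Iz|r x Jx z Iz|].
  - by rewrite mulr0.
  - by rewrite mulrDr; apply: RD; [exact: Jx|exact: Jy].
  - by rewrite mulrCA; apply: RM => //; exact: Jx.
  - by exists s`_d => // x; apply; exact: memI.
apply/seteqP; split=> [x [t tP ->]|_ [r _ <-]].
  rewrite big_seq; apply: (big_ind rangeR) => // p /tP[[y Iy <-] Jp].
  exact: Jp.
have Jx (i : 'I_(size s)) : J (tofrac (r * u i) / tofrac s`_i).
  move=> _ [c ->]; rewrite rmorph_sum mulr_suml /=.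
  apply: (big_ind rangeR) => // j _.
  have [si|si] := eqVneq s`_i 0; first by rewrite si rmorph0 invr0 !mulr0.
  have [q qE] := uP i j; exists (c j * r * q) => //.
  rewrite mulrA -rmorphM; apply: canRL (mulfK _) _; first by rewrite tofrac_eq0.
  by rewrite -rmorphM; congr tofrac; rewrite -!mulrA -qE; ring.
exists [seq (tofrac s`_i, tofrac (r * u i) / tofrac s`_i)
       | i : 'I_(size s) <- enum 'I_(size s)].
  move=> p /mapP[i _ ->]; split; last exact: Jx.
  by exists s`_i => //; exact: memI.
rewrite big_map big_enum /= -[r in LHS]mulr1 -u1 mulr_sumr rmorph_sum.
apply: eq_bigr => i _; rewrite mulrCA.
have [si|si] := eqVneq s`_i 0; first by rewrite u0 // si !mulr0 rmorph0 mul0r.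
by rewrite divff ?mulr1 // tofrac_eq0.
Qed.

End ArithmeticalPruefer.

(** * Polynomials separating 0 from the rest of the unit ball *)

Lemma exp_half_small (d : rat) : 0 < d -> exists n, 2^-1 ^+ n <= d.
Proof.
move=> d0; exists (Num.bound d^-1); rewrite exprVn invf_ple ?posrE ?exprn_gt0 //.
apply: le_trans (ltW (archi_boundP _)) _; first by rewrite invr_ge0 ltW.
by rewrite -natrX ler_nat ltnW // ltn_expl.
Qed.

(** The residue of $q$ is a nonzero element of $F_4$, so its cube is 1. *)
Lemma qabs_cube q : qabs q = 1 -> qabs (1 - q ^+ 3) <= 2^-1.
Proof.
move=> q1; have := @qabs_frobenius q; rewrite q1 lexx => /(_ isT).
have -> : q ^+ 4 - q = - ((1 - q ^+ 3) * q) by rewrite mulrBl mul1r -exprSr opprB.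
by rewrite qabsN qabsM q1 mulr1.
Qed.

Lemma horner_algZ (q : quat) (c : rat) (f : {poly rat}) :
  horner_alg q (c *: f) = c *: horner_alg q f.
Proof. by rewrite -mul_polyC rmorphM /= horner_algC mulr_algl. Qed.

(* Multiplying by 1 - (X^2/2^n)^3 extends the annihilated range by one step:
   it is small on the sphere |q| = 2^-n and integral inside it, and a high
   power of the previous polynomial absorbs its size outside. *)
Lemma separating_poly n : exists2 e : {poly rat}, e.[0] = 1 &
  forall q, qabs q <= 1 -> qabs (horner_alg q e) <= 1 /\
    (2^-1 ^+ n <= qabs q -> qabs (horner_alg q e) <= 2^-1).
Proof.
elim: n => [|n [e e0 eP]].
  exists (1 - 'X^3); first by rewrite !hornerE.
  move=> q q1; rewrite rmorphB rmorph1 rmorphXn /= horner_algX; split.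
    by apply: qabsB; rewrite ?qabs1 // qabsX exprn_ile1 ?qabs_ge0.
  by rewrite expr0 => q1'; apply: qabs_cube; apply/le_anti; rewrite q1.
(* A nonzero rational scalar has quaternion absolute value a power of 4, so ['X] is squared to let
   scaling by [c] move the sphere of radius $2^{-(n+1)}$ to the unit sphere. *)
pose c : rat := 2^-1 ^+ n.+1.
(* The new factor is at most $2^{6(n+1)}$ outside that sphere, and $2^{-M}$ times this bound is
   $1/2$. *)
pose M := (6 * n.+1).+1.
exists (e ^+ M * (1 - (c *: 'X ^+ 2) ^+ 3)).
  by rewrite !hornerE /= e0 expr1n mulr0 expr0n subr0 mulr1.
move=> q q1; have [ei es] := eP q q1.
rewrite rmorphM rmorphB rmorph1 !rmorphXn /= horner_algZ rmorphXn /= horner_algX.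
rewrite qabsM qabsX.
have cE : abs2 c ^+ 2 = 4 ^+ n.+1.
  by rewrite abs2X abs2V abs2_2 invrK exprAC -natrX.
have e2 : qabs (c *: q ^+ 2) = (2 ^+ n.+1 * qabs q) ^+ 2.
  by rewrite qabsZ qabsX cE exprMn exprAC -natrX.
have h0 := qabs_ge0 q.
have [qs|qs|qE] := ltgtP (qabs q) (2^-1 ^+ n.+1).
- have h : qabs (1 - (c *: q ^+ 2) ^+ 3) <= 1.
    apply: qabsB; rewrite ?qabs1 // qabsX e2 -exprM exprn_ile1 ?mulr_ge0 ?exprn_ge0 //.
    by rewrite -ler_pdivlMl ?exprn_gt0 // mulr1 -exprVn ltW.
  by split=> // ; rewrite mulr_ile1 ?exprn_ge0 ?qabs_ge0 ?exprn_ile1 ?qabs_ge0.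
(* By discreteness, $|q| > 2^{-(n+1)}$ already means $|q| \geq 2^{-n}$. *)
- have {}es : qabs (horner_alg q e) <= 2^-1.
    apply: es; rewrite leNgt; apply/negP => /abs2_discrete.
    by rewrite leNgt -/(qabs q) qs.
  have h : qabs (1 - (c *: q ^+ 2) ^+ 3) <= 2 ^+ (6 * n.+1).
    apply: qabsB; first by rewrite qabs1 exprn_ege1.
    rewrite qabsX e2 -exprM exprMn -exprM mulnC ler_piMr ?exprn_ge0 //.
    exact: exprn_ile1.
  suff s : qabs (horner_alg q e) ^+ M * qabs (1 - (c *: q ^+ 2) ^+ 3) <= 2^-1.
    by split=> //; apply: le_trans s _.
  apply: le_trans (ler_pM _ _ (lerXn2r _ _ _ es) h) _;
    rewrite ?exprn_ge0 ?qabs_ge0 ?nnegrE ?qabs_ge0 //.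
  by rewrite exprSr -mulrA mulrCA -exprMn mulVf // expr1n mulr1.
- have h : qabs (1 - (c *: q ^+ 2) ^+ 3) <= 2^-1.
    by apply: qabs_cube; rewrite e2 qE -exprMn divff // expr1n.
  suff s : qabs (horner_alg q e) ^+ M * qabs (1 - (c *: q ^+ 2) ^+ 3) <= 2^-1.
    by split=> //; apply: le_trans s _.
  by rewrite -[2^-1]mul1r ler_pM ?exprn_ge0 ?qabs_ge0 ?exprn_ile1 ?qabs_ge0.
Qed.

(** * Approximate inversion of the quartic form *)

Lemma horner_alg_comp (q : quat) (e f : {poly rat}) :
  horner_alg q (e \Po f) = horner_alg (horner_alg q f) e.
Proof.
elim/poly_ind: e => [|e c IH]; first by rewrite comp_poly0 !rmorph0.
by rewrite comp_poly_MXaddC !rmorphD !rmorphM /= IH !horner_algC horner_algX.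
Qed.

(** If $|q| < |p|$, then $p^4$ dominates. Otherwise, for $q \neq 0$, write $p = rq$ with $|r| \leq
    1$: the form is $(r^4 - r + 1) q^4$, and $|r^4 - r| < 1$ makes the first factor a unit. *)
Lemma quartic_form_ge (p q : quat) : p * q = q * p ->
  Num.max (qabs p) (qabs q) ^+ 4 <= qabs (p ^+ 4 - p * q ^+ 3 + q ^+ 4).
Proof.
move=> pq; have [qp|lepq] := ltP (qabs q) (qabs p).
  rewrite -addrA (addrC (p ^+ 4)).
  rewrite qabsD_lt ?qabsX //; have p0 := le_lt_trans (qabs_ge0 q) qp.
  have h : qabs p * qabs q ^+ 3 < qabs p ^+ 4.
    by rewrite [X in _ < X]exprS ltr_pM2l // ltrXn2r // ?qabs_ge0 // ltW.
  have h' : qabs q ^+ 4 < qabs p ^+ 4 by rewrite ltrXn2r // ?qabs_ge0 // ltW.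
  apply: le_lt_trans (_ : Num.max (qabs p * qabs q ^+ 3) (qabs q ^+ 4) < _).
    by apply: qabsD; rewrite ?qabsN ?qabsM ?qabsX le_max lexx ?orbT.
  by rewrite gt_max h h'.
have [q0|q0] := eqVneq q 0.
  by rewrite q0 qabs0 expr0n qabs_ge0.
have [r pE] := qdiv p q0; have qgt : 0 < qabs q by rewrite qabs_gt0.
have rq : r * q = q * r.
  (* Here $(rq - qr) q = pq - qp = 0$, and the norm is multiplicative. *)
  apply/eqP; rewrite -subr_eq0 -qnorm_eq0 -[_ == 0]orbF -(negbTE q0).
  rewrite -(qnorm_eq0 q) -mulf_eq0 -qnormM qnorm_eq0.
  by rewrite mulrBl -(mulrA q) -!pE pq subrr.
have r1 : qabs r <= 1 by move: lepq; rewrite pE qabsM ger_pMl.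
have -> : p ^+ 4 - p * q ^+ 3 + q ^+ 4 = (r ^+ 4 - r + 1) * q ^+ 4.
  by rewrite pE exprMn_comm // mulrDl mulrBl mul1r -mulrA -exprS.
rewrite qabsM qabsX qabsD_lt ?qabs1 ?mul1r //.
by apply: le_lt_trans (qabs_frobenius r1) _.
Qed.

Local Notation A := (hurwitz Zloc2).

Lemma intQP (f : {poly rat}) :
  reflect (forall a, qabs a <= 1 -> qabs (horner_alg a f) <= 1) (f \in intQ A).
Proof.
by apply: (iffP (asboolP _)) => h a; move: (h a); rewrite !qabs_le1.
Qed.

Lemma qabs_alg (c : rat) : qabs c%:A = abs2 c ^+ 2.
Proof. by rewrite qabsZ qabs1 mulr1. Qed.

(* With F = f^4 - f g^3 + g^4, every degree 4 monomial in f and g is a multiple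
   of F at each a, and 1 / F is approximated by psi = (1 - e(F)) / F, the error
   e(F) being divisible by the constant c of the ideal. *)
Lemma comaximal_inverse (f g u w : {poly rat}) (c : rat) : c != 0 ->
  f \in intQ A -> g \in intQ A -> u \in intQ A -> w \in intQ A ->
  u * f + w * g = c%:P ->
  exists x y, [/\ g * x + f * y = 1,
    f * x \in intQ A, g * x \in intQ A, f * y \in intQ A & g * y \in intQ A].
Proof.
move=> c0 Rf Rg Ru Rw bez.
have [/intQP hf /intQP hg /intQP hu /intQP hw] := And4 Rf Rg Ru Rw.
pose F := f ^+ 4 - f * g ^+ 3 + g ^+ 4.
pose d := abs2 c ^+ 2.
have d0 : 0 < d by rewrite exprn_gt0 // abs2_gt0.
(* With $d = |c|$, the relation [bez] gives $\max(|f|, |g|) \geq d$, hence $|F| \geq d^4$: [e0] must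
   be small from that radius on. Its [M]-th power is then at most $d$ there. *)
have [N hN] : exists N, 2^-1 ^+ N <= d ^+ 4 by apply: exp_half_small; rewrite exprn_gt0.
have [M hM] := exp_half_small d0.
have [e0 e01 e0P] := separating_poly N.
pose e := e0 ^+ M.
have [psi psiE] : exists psi, 1 - e = psi * 'X.
  have /factor_theorem[psi] : root (1 - e) 0.
    by rewrite /root !hornerE /= e01 expr1n subrr.
  by rewrite subr0 => ?; exists psi.
pose E := e \Po F; pose P := psi \Po F.
have PF : P * F = 1 - E.
  by rewrite /P /E -[X in _ * X](comp_polyX F) -comp_polyM -psiE comp_polyB comp_polyC.
have local a : qabs a <= 1 ->
    let: v := fun h => qabs (horner_alg a h) in
    v E <= d /\ v P * Num.max (v f) (v g) ^+ 4 <= 1.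
  move=> a1.
  have mM : d <= Num.max (qabs (horner_alg a f)) (qabs (horner_alg a g)).
    rewrite /d -qabs_alg -(horner_algC a) -bez rmorphD !rmorphM /=.
    by apply: qabsD; rewrite qabsM le_max ler_piMl ?orbT ?qabs_ge0 ?hu ?hw.
  have FM : Num.max (qabs (horner_alg a f)) (qabs (horner_alg a g)) ^+ 4
      <= qabs (horner_alg a F).
    have -> : horner_alg a F = horner_alg a f ^+ 4 -
        horner_alg a f * horner_alg a g ^+ 3 + horner_alg a g ^+ 4.
      by rewrite /F rmorphD rmorphB !rmorphXn /= rmorphM rmorphXn.
    by apply: quartic_form_ge; rewrite -!rmorphM mulrC.
  have F1 : qabs (horner_alg a F) <= 1.
    apply: (intQP _ _) a1; apply: rpredD (rpredX _ Rg).
    exact: rpredB (rpredX _ Rf) (rpredM Rf (rpredX _ Rg)).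
  have Ed : qabs (horner_alg a E) <= 2^-1 ^+ M.
    rewrite horner_alg_comp rmorphXn qabsX /= lerXn2r ?nnegrE ?qabs_ge0 //.
    apply: (e0P _ F1).2; apply: le_trans hN _; apply: le_trans FM.
    by apply: (lerXn2r _ _ _ mM); rewrite nnegrE ?(le_trans _ mM) ?ltW.
  split; first exact: le_trans hM.
  apply: le_trans (ler_wpM2l (qabs_ge0 _) FM) _.
  rewrite -qabsM -rmorphM PF rmorphB rmorph1; apply: qabsB; rewrite ?qabs1 //.
  by apply: le_trans Ed _; rewrite exprn_ile1.
have mono i j a : (i + j = 4)%N -> qabs (horner_alg a (f ^+ i * g ^+ j)) <=
    Num.max (qabs (horner_alg a f)) (qabs (horner_alg a g)) ^+ 4.
  move=> <-; rewrite rmorphM !rmorphXn qabsM !qabsX exprD.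
  by rewrite ler_pM ?exprn_ge0 ?qabs_ge0 ?lerXn2r ?nnegrE ?le_max ?qabs_ge0 ?lexx ?orbT.
(* The first summand is controlled by $|P| \max(|f|, |g|)^4 \leq 1$, the second by $|E| \leq
   |c|$. *)
have integral (h k : {poly rat}) : (forall a, qabs (horner_alg a h) <=
      Num.max (qabs (horner_alg a f)) (qabs (horner_alg a g)) ^+ 4) ->
    k \in intQ A -> P * h + c^-1 *: (k * E) \in intQ A.
  move=> hP /intQP kP; apply/intQP => a a1; have [vE vP] := local a a1.
  rewrite rmorphD /= horner_algZ !rmorphM /=; apply: qabsD.
    by rewrite qabsM; apply: le_trans vP; rewrite ler_wpM2l ?qabs_ge0 ?hP.
  rewrite qabsZ abs2V exprVn qabsM mulrC ler_pdivrMr // mul1r.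
  by apply: le_trans vE; rewrite ler_piMl ?qabs_ge0 ?kP.
(* As $g (g^3 - f g^2) + f^4 = F$ and $uf + wg = c$, one gets $gx + fy = PF + E = 1$. *)
pose x := P * (g ^+ 3 - f * g ^+ 2) + c^-1 *: (w * E).
pose y := P * f ^+ 3 + c^-1 *: (u * E).
have mulE (k l z : {poly rat}) :
  k * (P * l + c^-1 *: (z * E)) = P * (k * l) + c^-1 *: (k * z * E).
  by rewrite mulrDr mulrCA -scalerAr !mulrA.
exists x, y; rewrite /x /y !mulE; split.
- have -> : g * (g ^+ 3 - f * g ^+ 2) = F - f * f ^+ 3 by rewrite /F; ring.
  have -> : g * w * E = c%:P * E - f * u * E by rewrite -bez; ring.
  rewrite mulrBr PF scalerBr mul_polyC scalerA mulVf // scale1r.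
  by ring.
- apply: integral; last exact: rpredM.
  have -> : f * (g ^+ 3 - f * g ^+ 2) = f ^+ 1 * g ^+ 3 - f ^+ 2 * g ^+ 2 by ring.
  by move=> a; rewrite rmorphB; apply: qabsB; apply: mono.
- apply: integral; last exact: rpredM.
  have -> : g * (g ^+ 3 - f * g ^+ 2) = f ^+ 0 * g ^+ 4 - f ^+ 1 * g ^+ 3 by ring.
  by move=> a; rewrite rmorphB; apply: qabsB; apply: mono.
- apply: integral; last exact: rpredM.
  have -> : f * f ^+ 3 = f ^+ 4 * g ^+ 0 by ring.
  by move=> a; apply: mono.
- apply: integral; last exact: rpredM.
  have -> : g * f ^+ 3 = f ^+ 3 * g ^+ 1 by ring.
  by move=> a; apply: mono.
Qed.

(** * Two-generated ideals of the ring of integer-valued polynomials *)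

Lemma map_intr_intQ (p : {poly int}) : map_poly intr p \in intQ A.
Proof.
apply/asboolP => a Aa.
elim/poly_ind: p => [|p k IH]; first by rewrite map_poly0 rmorph0 rpred0.
rewrite rmorphD rmorphM /= map_polyX map_polyC /= rmorphD rmorphM /= horner_algX.
by rewrite horner_algC scaler_int rpredD ?rpredM ?rpredMz ?rpred1.
Qed.

Lemma common_denominator (s : seq {poly rat}) :
  exists2 m : int, m != 0 & {in s, forall f, m%:~R *: f \in intQ A}.
Proof.
elim: s => [|f s [m m0 IH]]; first by exists 1.
have [p [n n0 fE]] := rat_poly_scale f; exists (n * m); first exact: mulf_neq0.
move=> h; rewrite inE rmorphM -scalerA => /predU1P[->|hs]; last first.
  by rewrite scaler_int rpredMz ?IH.
rewrite scalerA mulrC -scalerA scaler_int rpredMz //.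
by rewrite fE scalerA divff ?intr_eq0 // scale1r map_intr_intQ.
Qed.

Lemma intQ_arithmetical : arithmetical (intQ_ring A).
Proof.
move=> f g; have [|fg0] := boolP ((val f == 0) && (val g == 0)).
  case/andP => /eqP f0 /eqP g0; exists 0, 0, 0.
  by split; apply: val_inj; rewrite !rmorphM /= ?f0 ?g0 !mulr0.
pose D := gcdp (val f) (val g).
have fD : val f = val f %/ D * D by rewrite divpK ?dvdp_gcdl.
have gD : val g = val g %/ D * D by rewrite divpK ?dvdp_gcdr.
set f1 := val f %/ D in fD; set g1 := val g %/ D in gD.
have /Bezout_eq1_coprimepP[[u1 w1] /= bez] : coprimep f1 g1.
  by apply: coprimep_div_gcd; rewrite -negb_and.
(* Scaling by [m] puts the cofactors in the ring and turns the Bézout constant 1 into $m^2$. *)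
have [m m0 mP] := common_denominator [:: f1; g1; u1; w1].
pose c : rat := m%:~R.
have c0 : c ^+ 2 != 0 by rewrite expf_neq0 // intr_eq0.
have [|||||x [y [xy fx gx fy gy]]] :=
    @comaximal_inverse (c *: f1) (c *: g1) (c *: u1) (c *: w1) (c ^+ 2) c0.
- by rewrite mP ?inE ?eqxx ?orbT.
- by rewrite mP ?inE ?eqxx ?orbT.
- by rewrite mP ?inE ?eqxx ?orbT.
- by rewrite mP ?inE ?eqxx ?orbT.
- by rewrite -!scalerAl -!scalerAr !scalerA -scalerDr bez alg_polyC.
(* Both identities reduce to $f_1 g_1 = g_1 f_1$ up to common factors, the second after replacing $1
   - gx$ by $fy$. *)
exists (IntQ gx), (IntQ fx), (IntQ gy); split; apply: val_inj.
  by rewrite !rmorphM /= fD gD -!scalerAl; congr (_ *: _); ring.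
rewrite !rmorphM rmorphB rmorph1 /= -xy addrC addKr fD gD -!scalerAl.
by congr (_ *: _); ring.
Qed.

Theorem theorem5p4 : pruefer_domain (intQ_ring (hurwitz Zloc2)).
Proof. exact: arithmetical_pruefer intQ_arithmetical. Qed.
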